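(* For every $s>0$ there exists a separable metric space $X$ with $\dim_H X\ge s$ such that there is no uniformly continuous function from $X$ onto a non-degenerate closed interval of $\mathbb{R}$. (This is proved in ZFC.)
   Context: $\dim_H$ denotes Hausdorff dimension. *)

(* Defs.v *)
From Stdlib Require Import Reals.
Open Scope R_scope.

Definition is_metric {X : Type} (d : X -> X -> R) : Prop :=
  (forall x y, 0 <= d x y) /\
  (forall x y, d x y = 0 <-> x = y) /\
  (forall x y, d x y = d y x) /\
  (forall x y z, d x z <= d x y + d y z).

Definition separable {X : Type} (d : X -> X -> R) : Prop :=
  (forall x : X, False) \/
  exists e : nat -> X, forall x eps, 0 < eps -> exists n, d x (e n) < eps.

Definition diam_le {X : Type} (d : X -> X -> R) (U : X -> Prop) (r : R) : Prop :=
  forall x y, U x -> U y -> d x y <= r.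

(* [hcover_sum_le d t delta A eps] : there is a countable delta-cover (U_i) of A
   with  sum_i diam(U_i)^t <= eps  (conventions: diam(empty)^t = 0, and for a
   nonempty set the term diam(U_i)^t is realised as the infimum of r^t over
   real numbers r > 0 with diam U_i <= r, which equals diam(U_i)^t for t > 0
   and equals 1 = diam(U_i)^0 for t = 0). Terms are given by w_i >= r_i^t. *)
Definition hcover_sum_le {X : Type} (d : X -> X -> R) (t delta : R)
    (A : X -> Prop) (eps : R) : Prop :=
  exists (U : nat -> X -> Prop) (r w : nat -> R),
    (forall x, A x -> exists i, U i x) /\
    (forall i, 0 <= w i) /\
    (forall i, (exists x, U i x) ->
        0 < r i /\ r i <= delta /\ diam_le d (U i) (r i) /\ Rpower (r i) t <= w i) /\
    (forall n, sum_f_R0 w n <= eps).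

(* H^t(A) = sup_{delta>0} H^t_delta(A) = 0, unfolded:
   H^t_delta(A) = 0 for every delta > 0. *)
Definition hausdorff_null {X : Type} (d : X -> X -> R) (t : R) (A : X -> Prop) : Prop :=
  forall delta eps, 0 < delta -> 0 < eps -> hcover_sum_le d t delta A eps.

(* dim_H X = inf { t >= 0 | H^t(X) = 0 }, so  dim_H X >= s  iff
   no t in [0, s) has H^t(X) = 0. *)
Definition hausdorff_dim_ge {X : Type} (d : X -> X -> R) (s : R) : Prop :=
  forall t, 0 <= t -> t < s -> ~ hausdorff_null d t (fun _ => True).

Definition unif_continuous {X : Type} (d : X -> X -> R) (f : X -> R) : Prop :=
  forall eps, 0 < eps -> exists delta, 0 < delta /\
    forall x y, d x y < delta -> Rabs (f x - f y) < eps.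

Definition onto_interval {X : Type} (f : X -> R) (a b : R) : Prop :=
  (forall x, a <= f x <= b) /\ (forall y, a <= y <= b -> exists x, f x = y).

(* Main.v *)
(** Write [2^N] for the Cantor space and call a type small if it does not surject onto
    [2^N]. Fix [q] with [q ^ s = 1/2] and give sequence spaces the metric [q ^ n], [n] the
    first index of difference; then [H^s] on [2^N] is comparable with the coin-tossing
    measure.

    If some small space of sequences of clopen codes has dimension at least [s], it is the
    required space, for cardinality reasons. Otherwise, covering the set of codes of a small
    family of closed null subsets of [2^N] efficiently shows that the union of the family is
    null. Enumerate all pairs of a cover of measure at most 1/4 and a code of a uniformly
    continuous function along a well-order with small initial segments. At each step choose
    a value whose fiber under the current function is null and contains no earlier point (all
    but countably many values have a null fiber), and then a point outside the current cover
    and all the fibers chosen so far. The resulting set is not null, and every uniformly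
    continuous function on it misses the value chosen for its code. *)

Require Import Defs.
From Stdlib Require Import Reals Lra Lia ZArith List Cantor Wf_nat.
From Stdlib Require Import Classical ClassicalEpsilon FunctionalExtensionality ProofIrrelevance.
From mathcomp Require boolp wochoice.
Import ListNotations.
#[local] Set Bullet Behavior "Strict Subproofs".
Open Scope R_scope.

(** * Surjections and well-orders with small initial segments *)

Definition surjects (A B : Type) : Prop :=
  exists f : A -> B, forall b, exists a, f a = b.

Lemma surjects_trans A B C : surjects A B -> surjects B C -> surjects A C.
Proof.
  intros [f Hf] [g Hg]. exists (fun a => g (f a)). intro c.
  destruct (Hg c) as [b <-]. destruct (Hf b) as [a <-]. now exists a.
Qed.

(** A partial map given by its graph extends to a total one, [epsilon] supplying arbitrary values
    off its domain. *)
Lemma surjects_of_cover (A B : Type) (b0 : B) (R : A -> B -> Prop) :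
  (forall a b b', R a b -> R a b' -> b = b') ->
  (forall b, exists a, R a b) -> surjects A B.
Proof.
  intros Hfun Hsurj. exists (fun a => epsilon (inhabits b0) (R a)). intro b.
  destruct (Hsurj b) as [a Ha]. exists a.
  apply (Hfun a); [apply epsilon_spec; now exists b | exact Ha].
Qed.

Lemma surjects_sig_range (I A B : Type) (f : I -> A) :
  surjects {a | exists i, a = f i} B -> surjects I B.
Proof.
  intros [g Hg].
  exists (fun i => g (exist _ (f i) (ex_intro _ i eq_refl))). intro b.
  destruct (Hg b) as [[a [i ->]] <-]. now exists i.
Qed.

Lemma well_founded_trichotomous (T : Type) :
  exists lt : T -> T -> Prop,
    well_founded lt /\ forall x y, lt x y \/ x = y \/ lt y x.
Proof.
  destruct (wochoice.well_ordering_principle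
    (boolp.boolp_classicType__canonical__eqtype_Equality T)) as [R HR].
  assert (Hmin : forall A : T -> Prop, (exists x, A x) ->
    exists z, (A z /\ forall x, A x -> R z x = true) /\
      forall z', A z' -> (forall x, A x -> R z' x = true) -> z = z').
  { intros A [x Ax].
    destruct (HR (fun x => boolp.asbool (A x))) as [z [[Hz1 Hz2] Hz3]].
    { exists x. exact (boolp.asboolT Ax). }
    exists z. split; [split|].
    - exact (boolp.asboolW Hz1).
    - intros y Ay. exact (Hz2 y (boolp.asboolT Ay)).
    - intros z' Az' Hz'. apply Hz3. split; [exact (boolp.asboolT Az')|].
      intros y Ay. exact (Hz' y (boolp.asboolW Ay)). }
  (* The strict order is the negation of the reversed [R]. A least inaccessible point would have
     only accessible predecessors; uniqueness of least elements, applied to pairs, gives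
     trichotomy. *)
  exists (fun x y => R y x <> true). split.
  - intro x. apply NNPP. intro Hx.
    destruct (Hmin (fun x => ~ Acc (fun x y => R y x <> true) x)) as [z [[Hz1 Hz2] _]].
    { now exists x. }
    apply Hz1. constructor. intros y Hy. apply NNPP. intro Hy'.
    exact (Hy (Hz2 y Hy')).
  - intros x y.
    destruct (classic (R y x = true)) as [Hyx|]; [|now left].
    destruct (classic (R x y = true)) as [Hxy|]; [|now right; right].
    right; left.
    assert (Hrefl : forall w, R w w = true).
    { intro w. destruct (Hmin (fun v => v = w)) as [z [[-> H] _]]; [now exists w|].
      now apply H. }
    destruct (Hmin (fun v => v = x \/ v = y)) as [z [_ Hz]]; [exists x; now left|].
    transitivity z; [symmetry|]; apply Hz; auto; intros w [-> | ->]; auto.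
Qed.

(** An initial-ordinal argument: cut a well-order of [T] at the least [t] whose initial segment
    still surjects onto [T], or keep all of [T] if there is no such [t]. *)
Lemma small_segments_well_order (T : Type) :
  exists (W : Type) (lt : W -> W -> Prop),
    well_founded lt /\ (forall x y, lt x y \/ x = y \/ lt y x) /\
    surjects W T /\ forall w, ~ surjects {v | lt v w} T.
Proof.
  destruct (well_founded_trichotomous T) as [lt [Hwf Htri]].
  destruct (classic (exists t, surjects {v | lt v t} T)) as [[t Ht]|Hno].
  - revert Ht. induction t as [t IH] using (well_founded_induction Hwf). intro Ht.
    destruct (classic (exists u, lt u t /\ surjects {v | lt v u} T)) as [[u [Hu Hs]]|Hmin].
    { now apply (IH u). }
    exists {v | lt v t}, (fun x y => lt (proj1_sig x) (proj1_sig y)).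
    split; [|split; [|split]].
    + intro x. destruct x as [x Hx].
      induction x as [x IHx] using (well_founded_induction Hwf).
      constructor. intros [y Hy] Hyx. now apply IHx.
    + intros [x Hx] [y Hy]. simpl.
      destruct (Htri x y) as [|[E|]]; auto.
      right; left. subst. f_equal. apply proof_irrelevance.
    + exact Ht.
    + intros [u Hu] [f Hf]. apply Hmin. exists u. split; [exact Hu|].
      (* A point of the segment inside [W] is determined by its underlying element of [T], so the
         surjection transfers to the segment below [u] and contradicts the minimality of [t]. *)
      apply (surjects_of_cover _ _ t
        (fun v b => exists H : lt (proj1_sig v) t,
           f (exist (fun v' : {v | lt v t} => lt (proj1_sig v') u)
                (exist _ (proj1_sig v) H) (proj2_sig v)) = b)).
      * intros [v Hv] b b' [H <-] [H' <-]. now rewrite (proof_irrelevance _ H H').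
      * intro b. destruct (Hf b) as [[[v Hv] Hvu] Hb].
        exists (exist _ v Hvu). exists Hv. exact Hb.
  - exists T, lt. split; [exact Hwf|]. split; [exact Htri|]. split.
    + exists (fun x => x). intro b. now exists b.
    + intros w Hw. apply Hno. now exists w.
Qed.

(** Transfinite recursion with choice: [P w f] depends only on [f] below [w], so [epsilon] can pick
    the value at [w] from the history, extended by [v0] to all of [W]. *)
Lemma well_founded_choice (W V : Type) (lt : W -> W -> Prop) (v0 : V)
    (P : W -> (W -> V) -> V -> Prop) :
  well_founded lt ->
  (forall w f g u, (forall v, lt v w -> f v = g v) -> P w f u -> P w g u) ->
  (forall w f, (forall v, lt v w -> P v f (f v)) -> exists u, P w f u) ->
  exists f, forall w, P w f (f w).
Proof.
  intros Hwf Hext Hstep.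
  set (ext := fun w (h : forall v, lt v w -> V) v =>
    match excluded_middle_informative (lt v w) with
    | left H => h v H | right _ => v0 end).
  set (F := fun w (h : forall v, lt v w -> V) => epsilon (inhabits v0) (P w (ext w h))).
  set (f := Fix Hwf (fun _ => V) F).
  assert (Hf : forall w, f w = F w (fun v _ => f v)).
  { intro w. unfold f. apply (Fix_eq Hwf (fun _ => V) F).
    intros x h h' E. f_equal. apply functional_extensionality_dep. intro y.
    apply functional_extensionality_dep. intro p. apply E. }
  exists f. intro w. induction w as [w IH] using (well_founded_induction Hwf).
  destruct (Hstep w f IH) as [u Hu].
  assert (Heq : forall v, lt v w -> f v = ext w (fun v _ => f v) v).
  { intros v Hv. unfold ext. now destruct (excluded_middle_informative (lt v w)). }
  rewrite Hf. unfold F.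
  apply (Hext w (ext w (fun v _ => f v))).
  - intros v Hv. symmetry. now apply Heq.
  - apply epsilon_spec. exists u. now apply (Hext w f).
Qed.

(** * Countability and the continuum *)

Lemma surjects_nat_pair A B : surjects nat A -> surjects nat B -> surjects nat (A * B).
Proof.
  intros [f Hf] [g Hg].
  exists (fun n => (f (fst (of_nat n)), g (snd (of_nat n)))). intros [a b].
  destruct (Hf a) as [i <-]. destruct (Hg b) as [j <-].
  exists (to_nat (i, j)). now rewrite cancel_of_to.
Qed.

Lemma surjects_nat_list A : surjects nat A -> surjects nat (list A).
Proof.
  intros [f Hf].
  set (dec := fix dec k n := match k with
    | O => nil | S k => f (fst (of_nat n)) :: dec k (snd (of_nat n)) end).
  exists (fun n => dec (fst (of_nat n)) (snd (of_nat n))). intro l.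
  assert (H : exists n, dec (length l) n = l).
  { induction l as [|a l [n IH]]; [now exists O|].
    destruct (Hf a) as [i <-]. exists (to_nat (i, n)).
    change (f (fst (of_nat (to_nat (i, n)))) :: dec (length l) (snd (of_nat (to_nat (i, n))))
      = f i :: l).
    rewrite cancel_of_to. simpl. now rewrite IH. }
  destruct H as [n Hn]. exists (to_nat (length l, n)). now rewrite cancel_of_to.
Qed.

Lemma surjects_nat_bool : surjects nat bool.
Proof.
  exists (fun n => match n with O => true | _ => false end).
  intros []; [now exists O | now exists 1%nat].
Qed.

Lemma surjects_nat_nat : surjects nat nat.
Proof. exists (fun n => n). intro n. now exists n. Qed.

(** A function between countable types is coded by its graph, a subset of [nat * nat] and hence, by
    pairing, a binary sequence. *)
Lemma surjects_cantor_fun (D E : Type) :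
  surjects nat D -> surjects nat E -> surjects (nat -> bool) (D -> E).
Proof.
  intros [f Hf] [g Hg].
  set (code := fun d => epsilon (inhabits O) (fun n => f n = d)).
  assert (Hcode : forall d, f (code d) = d).
  { intro d. unfold code. apply epsilon_spec. apply Hf. }
  exists (fun b d => g (epsilon (inhabits O) (fun k => b (to_nat (code d, k)) = true))).
  intro phi.
  set (idx := fun d => epsilon (inhabits O) (fun n => g n = phi d)).
  assert (Hidx : forall d, g (idx d) = phi d).
  { intro d. unfold idx. apply epsilon_spec. apply Hg. }
  exists (fun j => Nat.eqb (idx (f (fst (of_nat j)))) (snd (of_nat j))).
  apply functional_extensionality. intro d.
  rewrite <- (Hidx d). f_equal.
  match goal with |- epsilon _ ?P = _ =>
    replace P with (fun k => Nat.eqb (idx d) k = true) end.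
  - symmetry. apply Nat.eqb_eq.
    apply (epsilon_spec (inhabits O) (fun k => Nat.eqb (idx d) k = true)).
    exists (idx d). apply Nat.eqb_refl.
  - apply functional_extensionality. intro k. rewrite cancel_of_to.
    unfold fst, snd. now rewrite Hcode.
Qed.

(** A duplicate-free list in [P] of maximal length already contains every member of [P]. *)
Lemma finite_of_bounded_length (A : Type) (P : A -> Prop) (k : nat) :
  (forall l, NoDup l -> (forall a, In a l -> P a) -> (length l <= k)%nat) ->
  exists l, forall a, P a -> In a l.
Proof.
  induction k as [|k IH]; intro H.
  - exists nil. intros a Pa.
    assert (H1 : (length [a] <= 0)%nat); [|simpl in H1; lia].
    apply H; [repeat constructor; simpl; tauto|]. intros b [<-|[]]. exact Pa.
  - destruct (classic (exists l, NoDup l /\ (forall a, In a l -> P a) /\ length l = S k))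
      as [[l [H1 [H2 H3]]]|Hno].
    + exists l. intros a Pa. apply NNPP. intro Ha.
      assert (H4 : (length (a :: l) <= S k)%nat); [|simpl in H4; lia].
      apply H; [now constructor|]. intros b [<-|Hb]; auto.
    + apply IH. intros l H1 H2.
      assert (H3 := H l H1 H2).
      destruct (Nat.eq_dec (length l) (S k)); [|lia]. exfalso. apply Hno. now exists l.
Qed.

Lemma first_difference (T : Type) (x y : nat -> T) :
  x <> y -> exists n, x n <> y n /\ forall k, (k < n)%nat -> x k = y k.
Proof.
  intro Hne.
  destruct (not_all_ex_not _ (fun n => x n = y n)) as [n Hn].
  { intro H. apply Hne. now apply functional_extensionality. }
  revert Hn. induction n as [n IH] using lt_wf_ind. intro Hn.
  destruct (classic (exists k, (k < n)%nat /\ x k <> y k)) as [[k [Hk Hk']]|Hno].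
  { now apply (IH k). }
  exists n. split; [exact Hn|]. intros k Hk. apply NNPP. intro H. apply Hno. now exists k.
Qed.

Fixpoint ternary_sum (b : nat -> bool) (n : nat) : R :=
  match n with
  | O => 0
  | S n => ternary_sum b n + (if b n then (/3) ^ S n else 0)
  end.

(** Binary digits are read in base 3: at the first difference the digit contributes [3^-(n+1)],
    while all later digits together contribute at most half of that. *)
Lemma cantor_embedding :
  exists psi : (nat -> bool) -> R,
    (forall b, 0 <= psi b <= 1) /\ (forall b b', psi b = psi b' -> b = b').
Proof.
  assert (Hp : forall n, 0 < (/3) ^ n) by (intro; apply pow_lt; lra).
  assert (Hmono : forall b n k, ternary_sum b n <= ternary_sum b (n + k)%nat).
  { intros b n k. induction k as [|k IH]; [rewrite Nat.add_0_r; lra|].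
    rewrite Nat.add_succ_r. assert (H := Hp (n + k)%nat). cbn [ternary_sum pow].
    destruct (b (n + k)%nat); lra. }
  (* The tail from [n] on is at most the geometric sum [3^-(n+1) + 3^-(n+2) + ... = 3^-n / 2]. *)
  assert (Htail : forall b n k, ternary_sum b (n + k)%nat + (/3) ^ (n + k) / 2 <= ternary_sum b n + (/3) ^ n / 2).
  { intros b n k. induction k as [|k IH]; [rewrite Nat.add_0_r; lra|].
    rewrite Nat.add_succ_r. cbn [ternary_sum pow]. assert (H := Hp (n + k)%nat).
    destruct (b (n + k)%nat); lra. }
  assert (Hub : forall b n j, ternary_sum b j <= ternary_sum b n + (/3) ^ n / 2).
  { intros b n j. assert (H := Hp n). destruct (Nat.le_ge_cases n j) as [L|L].
    - replace j with (n + (j - n))%nat by lia.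
      assert (H1 := Htail b n (j - n)%nat). assert (H2 := Hp (n + (j - n))%nat). lra.
    - assert (H1 := Hmono b j (n - j)%nat). replace (j + (n - j))%nat with n in H1 by lia. lra. }
  assert (Hlub : forall b, { m | is_lub (fun y => exists n, y = ternary_sum b n) m }).
  { intro b. apply completeness.
    - exists (ternary_sum b 0 + (/3) ^ 0 / 2). intros y [n ->]. apply Hub.
    - exists (ternary_sum b 0). now exists O. }
  set (psi := fun b => proj1_sig (Hlub b)).
  assert (Hlow : forall b n, ternary_sum b n <= psi b).
  { intros b n. unfold psi. destruct (Hlub b) as [m [H1 H2]]. simpl. apply H1. now exists n. }
  assert (Hup : forall b n, psi b <= ternary_sum b n + (/3) ^ n / 2).
  { intros b n. unfold psi. destruct (Hlub b) as [m [H1 H2]]. simpl. apply H2.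
    intros y [j ->]. apply Hub. }
  assert (Hlt : forall b b' n, (forall k, (k < n)%nat -> b k = b' k) ->
    b n = false -> b' n = true -> psi b < psi b').
  { intros b b' n Hk Hb Hb'.
    assert (E : ternary_sum b n = ternary_sum b' n).
    { revert Hk. clear Hb Hb'. induction n as [|n IH]; intro Hk; [reflexivity|].
      simpl. rewrite IH, (Hk n); auto. }
    assert (H1 := Hup b (S n)). assert (H2 := Hlow b' (S n)). assert (H3 := Hp n).
    cbn [ternary_sum pow] in H1, H2. rewrite Hb in H1. rewrite Hb' in H2. lra. }
  exists psi. split.
  - intro b. assert (H1 := Hlow b O). assert (H2 := Hup b O). simpl in H1, H2. lra.
  - intros b b' E. apply NNPP. intro Hne.
    destruct (first_difference _ _ _ Hne) as [n [Hn Hk]].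
    destruct (b n) eqn:Hb; destruct (b' n) eqn:Hb'; try congruence.
    + assert (H : psi b' < psi b); [|lra]. apply (Hlt _ _ n); auto.
      intros; symmetry; auto.
    + assert (H : psi b < psi b'); [|lra]. now apply (Hlt _ _ n).
Qed.

(** * Sequence spaces with first-difference metrics *)

Definition agree {T : Type} (n : nat) (x y : nat -> T) : Prop :=
  forall k, (k < n)%nat -> x k = y k.

Definition first_diff {T : Type} (x y : nat -> T) : nat :=
  epsilon (inhabits O) (fun n => x n <> y n /\ agree n x y).

Definition seq_dist {T : Type} (q : R) (x y : nat -> T) : R :=
  if excluded_middle_informative (x = y) then 0 else q ^ first_diff x y.

Definition sub_dist {T : Type} (q : R) (P : (nat -> T) -> Prop) (u v : {x | P x}) : R :=
  seq_dist q (proj1_sig u) (proj1_sig v).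

Lemma pow_decr (q : R) (m n : nat) : 0 < q < 1 -> (m <= n)%nat -> q ^ n <= q ^ m.
Proof.
  intros Hq H. replace n with (m + (n - m))%nat by lia. rewrite pow_add.
  assert (H1 : 0 < q ^ m) by (apply pow_lt; lra).
  assert (H2 : q ^ (n - m) <= 1 ^ (n - m)) by (apply pow_incr; lra).
  rewrite pow1 in H2. nra.
Qed.

Lemma pow_strict_decr (q : R) (m n : nat) : 0 < q < 1 -> (m < n)%nat -> q ^ n < q ^ m.
Proof.
  intros Hq H. assert (H1 : q ^ n <= q ^ S m) by (apply pow_decr; [lra|lia]).
  assert (H2 : 0 < q ^ m) by (apply pow_lt; lra). simpl in H1. nra.
Qed.

Lemma pow_arbitrarily_small (q eps : R) : 0 < q < 1 -> 0 < eps -> exists n, q ^ n < eps.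
Proof.
  intros Hq He. destruct (pow_lt_1_zero q) with (y := eps) as [n Hn]; auto.
  { rewrite Rabs_pos_eq; lra. }
  exists n. specialize (Hn n (Nat.le_refl n)).
  rewrite Rabs_pos_eq in Hn; auto. apply pow_le; lra.
Qed.

Lemma seq_dist_le_pow {T : Type} (q : R) (x y : nat -> T) (n : nat) :
  0 < q < 1 -> seq_dist q x y <= q ^ n <-> agree n x y.
Proof.
  intro Hq. unfold seq_dist. destruct (excluded_middle_informative (x = y)) as [->|Hne].
  - split; intros _; [easy|]. apply pow_le; lra.
  - assert (H : x (first_diff x y) <> y (first_diff x y) /\ agree (first_diff x y) x y).
    { apply (epsilon_spec (inhabits O) (fun n => x n <> y n /\ agree n x y)).
      now apply first_difference. }
    destruct H as [H1 H2]. split.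
    + intros H k Hk. apply H2.
      destruct (Nat.lt_ge_cases (first_diff x y) n) as [L|L]; [|lia].
      apply (pow_strict_decr q) in L; lra.
    + intro H. apply pow_decr; auto.
      destruct (Nat.lt_ge_cases (first_diff x y) n) as [L|L]; auto.
      elim H1. now apply H.
Qed.

Lemma seq_dist_cases {T : Type} (q : R) (x y : nat -> T) :
  (x = y /\ seq_dist q x y = 0) \/ exists n, seq_dist q x y = q ^ n.
Proof.
  unfold seq_dist. destruct (excluded_middle_informative (x = y)); eauto.
Qed.

Lemma seq_dist_refl {T : Type} (q : R) (x : nat -> T) : seq_dist q x x = 0.
Proof. unfold seq_dist. now destruct (excluded_middle_informative (x = x)). Qed.

Lemma sub_dist_metric {T : Type} (q : R) (P : (nat -> T) -> Prop) :
  0 < q < 1 -> is_metric (sub_dist q P).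
Proof.
  intro Hq.
  assert (Hpos : forall x y : nat -> T, 0 <= seq_dist q x y).
  { intros x y. destruct (seq_dist_cases q x y) as [[_ ->]|[n ->]]; [lra|].
    apply pow_le; lra. }
  (* Distances take only the values [0] and [q ^ n], so they are compared through the lengths of
     agreement. *)
  assert (Hle : forall x y z w : nat -> T,
    (forall n, agree n x y -> agree n z w) -> seq_dist q z w <= seq_dist q x y).
  { intros x y z w H. destruct (seq_dist_cases q x y) as [[-> E]|[n E]].
    - replace w with z; [rewrite seq_dist_refl; apply Hpos|].
      apply functional_extensionality. intro n. apply (H (S n)); [now intros k _|lia].
    - rewrite E. apply seq_dist_le_pow; auto. apply H. apply (seq_dist_le_pow q); auto. lra. }
  unfold sub_dist. split; [|split; [|split]].
  - intros; apply Hpos.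
  - intros [x Hx] [y Hy]; simpl. split.
    + intro E. destruct (seq_dist_cases q x y) as [[-> _]|[n En]].
      * f_equal. apply proof_irrelevance.
      * assert (H := pow_lt q n). lra.
    + intro E. injection E as ->. apply seq_dist_refl.
  - intros [x Hx] [y Hy]; simpl. apply Rle_antisym; apply Hle; intros n H k Hk; symmetry; auto.
  - intros [x Hx] [y Hy] [z Hz]; simpl.
    assert (H1 := Hpos x y). assert (H2 := Hpos y z).
    destruct (seq_dist_cases q x y) as [[-> E]|[n E]]; [lra|].
    destruct (seq_dist_cases q y z) as [[<- E']|[m E']]; [lra|].
    assert (A1 : agree n x y) by (apply (seq_dist_le_pow q); auto; lra).
    assert (A2 : agree m y z) by (apply (seq_dist_le_pow q); auto; lra).
    destruct (Nat.le_ge_cases n m) as [L|L].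
    + assert (H : seq_dist q x z <= q ^ n); [|lra].
      apply seq_dist_le_pow; auto. intros k Hk. rewrite A1 by auto. apply A2. lia.
    + assert (H : seq_dist q x z <= q ^ m); [|lra].
      apply seq_dist_le_pow; auto. intros k Hk. rewrite A1 by lia. apply A2. lia.
Qed.

Fixpoint pre {T : Type} (n : nat) (x : nat -> T) : list T :=
  match n with O => nil | S n => x O :: pre n (fun k => x (S k)) end.

Fixpoint cyl {T : Type} (sigma : list T) (x : nat -> T) : Prop :=
  match sigma with nil => True | a :: tau => x O = a /\ cyl tau (fun k => x (S k)) end.

Lemma length_pre {T : Type} n (x : nat -> T) : length (pre n x) = n.
Proof. revert x. induction n; intro x; simpl; auto. Qed.

Lemma pre_last {T : Type} n (x : nat -> T) : pre (S n) x = pre n x ++ [x n].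
Proof.
  revert x. induction n as [|n IH]; intro x; [reflexivity|].
  change (x O :: pre (S n) (fun k => x (S k)) = pre (S n) x ++ [x (S n)]).
  rewrite IH. reflexivity.
Qed.

Lemma cyl_pre {T : Type} n (x y : nat -> T) : cyl (pre n x) y <-> agree n y x.
Proof.
  revert x y. induction n as [|n IH]; intros x y; simpl.
  - split; [|easy]. intros _ k Hk. lia.
  - rewrite IH. split.
    + intros [H1 H2] [|k] Hk; auto. apply H2. lia.
    + intro H. split; [apply H; lia|]. intros k Hk. apply (H (S k)). lia.
Qed.

Lemma cyl_inv {T : Type} (sigma : list T) (x : nat -> T) :
  cyl sigma x -> sigma = pre (length sigma) x.
Proof.
  revert x. induction sigma as [|a tau IH]; intros x; simpl; auto.
  intros [<- H]. f_equal. now apply IH.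
Qed.

Lemma agree_sym {T : Type} n (x y : nat -> T) : agree n x y -> agree n y x.
Proof. intros H k Hk. symmetry. auto. Qed.

Lemma sub_dist_separable {T : Type} (q : R) (P : (nat -> T) -> Prop) :
  0 < q < 1 -> surjects nat T -> separable (sub_dist q P).
Proof.
  intros Hq HT. destruct (classic (exists x, P x)) as [[x0 Hx0]|Hno].
  2: { left. intros [x Hx]. apply Hno. now exists x. }
  right. destruct (surjects_nat_list _ HT) as [dec Hdec].
  set (u0 := exist P x0 Hx0).
  (* One point is picked in each cylinder that meets [P]; the default [u0] serves the other
     cylinders. *)
  exists (fun n => epsilon (inhabits u0) (fun u => cyl (dec n) (proj1_sig u))).
  intros x eps He. destruct (pow_arbitrarily_small q eps Hq He) as [n Hn].
  destruct (Hdec (pre n (proj1_sig x))) as [i Hi]. exists i.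
  apply Rle_lt_trans with (q ^ n); auto. unfold sub_dist. apply seq_dist_le_pow; auto.
  apply agree_sym, cyl_pre. rewrite <- Hi.
  apply (epsilon_spec (inhabits u0) (fun u => cyl (dec i) (proj1_sig u))).
  exists x. rewrite Hi. apply cyl_pre. now intros k _.
Qed.

Lemma pow_sandwich (q rho : R) :
  0 < q < 1 -> 0 < rho < 1 -> exists k, q ^ S k <= rho < q ^ k.
Proof.
  intros Hq Hr. destruct (pow_arbitrarily_small q rho Hq) as [n Hn]; [lra|].
  induction n as [|n IH]; [simpl in Hn; lra|].
  destruct (Rlt_le_dec (q ^ n) rho) as [H|H]; auto.
  destruct (Rle_lt_or_eq_dec _ _ H) as [H'|E]; [exists n; lra|].
  destruct n as [|n]; [simpl in E; lra|]. exists n.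
  split; [lra|]. rewrite E. apply pow_strict_decr; auto.
Qed.

Lemma Rpower_pow_half (s q : R) (n : nat) :
  0 < q -> Rpower q s = /2 -> Rpower (q ^ n) s = (/2) ^ n.
Proof.
  intros Hq E. rewrite <- Rpower_pow by auto. rewrite Rpower_mult, Rmult_comm.
  rewrite <- Rpower_mult, E. apply Rpower_pow. lra.
Qed.

(* With [q ^ s = 1/2], a set of diameter at most [rho], where [q^(k+1) <= rho < q^k], has
   all its members equal up to index [k], and [rho^t >= rho^s >= (1/2)^(k+1)]. *)
Lemma hausdorff_null_agree {T : Type} (s q t : R) (P : (nat -> T) -> Prop) (eps : R) :
  0 < s -> 0 < q < 1 -> Rpower q s = /2 -> 0 <= t < s -> 0 < eps ->
  hausdorff_null (sub_dist q P) t (fun _ => True) ->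
  exists (U : nat -> (nat -> T) -> Prop) (k : nat -> nat) (w : nat -> R),
    (forall x, P x -> exists i, U i x) /\
    (forall i x, U i x -> P x /\ (/2) ^ S (k i) <= w i) /\
    (forall i x y, U i x -> U i y -> agree (S (k i)) x y) /\
    (forall i, 0 <= w i) /\
    (forall n, sum_f_R0 w n <= eps).
Proof.
  intros Hs Hq Eq Ht He Hnull.
  (* Taking [delta = q] keeps every diameter bound below 1, so that [pow_sandwich] applies. *)
  destruct (Hnull q eps) as [U [r [w [Hcov [Hw [Hr Hsum]]]]]]; [lra|auto|].
  set (V := fun i x => exists H : P x, U i (exist _ x H)).
  assert (Hk : forall i, exists k, (exists x, V i x) -> q ^ S k <= r i < q ^ k).
  { intro i. destruct (classic (exists x, V i x)) as [[x [Hx Ux]]|Hno].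
    - destruct (Hr i) as [H1 [H2 _]]; [now exists (exist _ x Hx)|].
      destruct (pow_sandwich q (r i)) as [k Hk]; [auto|lra|]. now exists k.
    - exists O. now intro. }
  apply choice in Hk. destruct Hk as [k Hk].
  exists V, k, w. split; [|split; [|split; [|split]]]; auto.
  - intros x Hx. destruct (Hcov (exist _ x Hx) I) as [i Hi]. exists i. now exists Hx.
  - intros i x Vx. specialize (Hk i (ex_intro _ x Vx)). destruct Vx as [Hx Ux].
    split; auto. destruct (Hr i) as [H1 [H2 [_ H4]]]; [now exists (exist _ x Hx)|].
    apply Rle_trans with (Rpower (r i) t); auto.
    rewrite <- (Rpower_pow_half s q) by (auto; lra).
    apply Rle_trans with (Rpower (r i) s).
    + apply Rle_Rpower_l; [lra|]. split; [apply pow_lt|]; lra.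
    + unfold Rpower.
      assert (Hln : ln (r i) <= 0).
      { rewrite <- ln_1. left. apply ln_increasing; lra. }
      assert (Hm : s * ln (r i) <= t * ln (r i)) by nra.
      destruct Hm as [Hm|Hm]; [left; now apply exp_increasing|rewrite Hm; lra].
  - intros i x y Vx Vy. assert (Hki := Hk i (ex_intro _ x Vx)).
    destruct Vx as [Hx Ux]. destruct Vy as [Hy Uy].
    destruct (Hr i) as [H1 [H2 [H3 _]]]; [now exists (exist _ x Hx)|].
    specialize (H3 _ _ Ux Uy). unfold sub_dist in H3. simpl in H3.
    destruct (seq_dist_cases q x y) as [[-> _]|[n E]]; [now intros j _|].
    assert (A : agree n x y) by (apply (seq_dist_le_pow q); auto; lra).
    intros j Hj. apply A.
    (* From [q ^ n <= r i < q ^ k i] follows [n > k i]; the strict upper bound is what yields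
       agreement at index [k i] itself. *)
    destruct (Nat.le_gt_cases n (k i)) as [L|L]; [|lia].
    apply (pow_decr q) in L; auto. lra.
Qed.

(** * Covers of the Cantor space by clopen sets *)

Definition sum_list {A : Type} (F : A -> R) (l : list A) : R :=
  fold_right (fun a s => F a + s) 0 l.

Definition clopen (l : list (list bool)) (x : nat -> bool) : Prop :=
  exists sigma, In sigma l /\ cyl sigma x.

(** Overlapping cylinders are counted with multiplicity, so this bounds the coin-tossing measure of
    [clopen l] from above. *)
Definition mu (l : list (list bool)) : R := sum_list (fun sigma => (/2) ^ length sigma) l.

Definition covered (eps : R) (A : (nat -> bool) -> Prop) : Prop :=
  exists c : nat -> list (list bool),
    (forall x, A x -> exists i, clopen (c i) x) /\
    (forall n, sum_f_R0 (fun i => mu (c i)) n <= eps).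

Definition clopen_covered (eps : R) (A : (nat -> bool) -> Prop) : Prop :=
  exists l, (forall x, A x -> clopen l x) /\ mu l <= eps.

Lemma sum_list_app {A : Type} (F : A -> R) l l' :
  sum_list F (l ++ l') = sum_list F l + sum_list F l'.
Proof. induction l as [|a l IH]; simpl; [lra|]. rewrite IH. lra. Qed.

Lemma sum_list_le {A : Type} (F G : A -> R) l :
  (forall a, In a l -> F a <= G a) -> sum_list F l <= sum_list G l.
Proof.
  induction l as [|a l IH]; intro H; simpl; [lra|].
  assert (H1 : F a <= G a) by (apply H; now left).
  assert (H2 : sum_list F l <= sum_list G l); [|lra].
  apply IH. intros b Hb. apply H. now right.
Qed.

Lemma sum_list_const {A : Type} (c : R) (l : list A) :
  sum_list (fun _ => c) l = INR (length l) * c.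
Proof.
  induction l as [|a l IH]; [simpl; lra|].
  cbn [sum_list fold_right length]. fold (sum_list (fun _ => c) l). rewrite IH, S_INR. lra.
Qed.

Lemma mu_nonneg l : 0 <= mu l.
Proof.
  unfold mu. induction l as [|a l IH]; simpl; [lra|].
  assert (H : 0 < (/2) ^ length a) by (apply pow_lt; lra). lra.
Qed.

Lemma mu_ge l sigma : In sigma l -> (/2) ^ length sigma <= mu l.
Proof.
  induction l as [|a l IH]; intros H; [easy|]. change (mu (a :: l)) with ((/2) ^ length a + mu l).
  assert (H1 := mu_nonneg l). destruct H as [->|H]; [lra|].
  assert (H2 : 0 < (/2) ^ length a) by (apply pow_lt; lra). specialize (IH H). lra.
Qed.

Lemma clopen_app l l' x : clopen (l ++ l') x <-> clopen l x \/ clopen l' x.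
Proof.
  unfold clopen. split.
  - intros [s [H1 H2]]. apply in_app_or in H1. destruct H1; [left|right]; eauto.
  - intros [[s [H1 H2]]|[s [H1 H2]]]; exists s; split; auto; apply in_or_app; auto.
Qed.

(** The part of the list lying in the half [x 0 = b], rescaled to the whole space; the empty string,
    which lies in neither half, is dropped. *)
Definition tails (b : bool) (l : list (list bool)) : list (list bool) :=
  flat_map (fun sigma => match sigma with
    | a :: tau => if Bool.eqb a b then [tau] else []
    | [] => [] end) l.

Lemma in_tails b l tau : In tau (tails b l) <-> In (b :: tau) l.
Proof.
  unfold tails. rewrite in_flat_map. split.
  - intros [[|a s] [H1 H2]]; [easy|]. destruct (Bool.eqb a b) eqn:E; [|easy].
    apply Bool.eqb_prop in E. destruct H2 as [<-|[]]. now subst.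
  - intro H. exists (b :: tau). split; auto. rewrite Bool.eqb_reflx. now left.
Qed.

Lemma mu_tails l : ~ In [] l -> mu l = /2 * (mu (tails true l) + mu (tails false l)).
Proof.
  induction l as [|[|a s] l IH]; intro H.
  - unfold mu; simpl; lra.
  - elim H. now left.
  - change (mu ((a :: s) :: l)) with (/2 * (/2) ^ length s + mu l).
    rewrite IH by (intro; apply H; now right).
    destruct a; cbn [tails flat_map Bool.eqb app].
    + fold (tails true l) (tails false l).
      change (mu (s :: tails true l)) with ((/2) ^ length s + mu (tails true l)). lra.
    + fold (tails true l) (tails false l).
      change (mu (s :: tails false l)) with ((/2) ^ length s + mu (tails false l)). lra.
Qed.

(** Induction on the maximal length of a string: each half of the space is covered by its own tails,
    and [mu] is the average over the halves. *)
Lemma mu_full l : (forall x, clopen l x) -> 1 <= mu l.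
Proof.
  assert (Hb : exists m, forall s, In s l -> (length s <= m)%nat).
  { induction l as [|a l [m IH]]; [exists O; easy|]. exists (length a + m)%nat.
    intros s [<-|H]; [lia|]. specialize (IH s H). lia. }
  destruct Hb as [m Hm]. revert l Hm.
  induction m as [|m IH]; intros l Hm Hfull;
    (destruct (classic (In [] l)) as [Hnil|Hnil]; [apply (mu_ge l []); auto|]).
  - destruct (Hfull (fun _ => true)) as [s [Hs _]].
    specialize (Hm s Hs). destruct s; simpl in Hm; [easy|lia].
  - assert (Ht : forall b, 1 <= mu (tails b l)).
    { intro b. apply IH.
      - intros s Hs. apply in_tails in Hs. apply Hm in Hs. simpl in Hs. lia.
      - intro x. destruct (Hfull (fun k => match k with O => b | S k => x k end)) as [s [H1 H2]].
        destruct s as [|a s]; [easy|]. destruct H2 as [<- H2].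
        exists s. split; [now apply in_tails|exact H2]. }
    rewrite mu_tails by auto. assert (H1 := Ht true). assert (H2 := Ht false). lra.
Qed.

(** König's lemma: if no finite subcover exists, some branch runs through cylinders without finite
    subcovers, yet the limit point lies in a cylinder of the cover. *)
Lemma cantor_compact (c : nat -> list (list bool)) :
  (forall x, exists i, clopen (c i) x) ->
  exists n, forall x, exists i, (i <= n)%nat /\ clopen (c i) x.
Proof.
  intro Hcov.
  set (good := fun sigma => exists n, forall x, cyl sigma x ->
    exists i, (i <= n)%nat /\ clopen (c i) x).
  assert (Hsplit : forall k x, good (pre k x ++ [true]) -> good (pre k x ++ [false]) ->
    good (pre k x)).
  { intros k x [n Hn] [m Hm]. exists (n + m)%nat. intros y Hy. apply cyl_pre in Hy.
    assert (E : pre k x ++ [y k] = pre (S k) y).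
    { rewrite pre_last. f_equal. apply cyl_pre, cyl_inv in Hy. now rewrite length_pre in Hy. }
    assert (Hself : cyl (pre (S k) y) y) by (apply cyl_pre; now intros j _).
    rewrite <- E in Hself.
    destruct (y k).
    - destruct (Hn y Hself) as [i [H1 H2]]. exists i. split; [lia|auto].
    - destruct (Hm y Hself) as [i [H1 H2]]. exists i. split; [lia|auto]. }
  apply NNPP. intro Hbad.
  (* By [Hsplit], a bad node has a bad child: [true] unless that child is good, and [false]
     otherwise. *)
  set (pick := fun sigma => if excluded_middle_informative (good (sigma ++ [true]))
    then false else true).
  set (st := fix st n := match n with O => [] | S n => st n ++ [pick (st n)] end).
  set (x := fun n => pick (st n)).
  assert (Hst : forall n, st n = pre n x).
  { induction n as [|n IH]; [reflexivity|]. rewrite pre_last, <- IH. reflexivity. }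
  assert (Hbr : forall n, ~ good (pre n x)).
  { induction n as [|n IH].
    - intros [n Hn]. apply Hbad. exists n. intro y. now apply Hn.
    - rewrite pre_last. unfold x at 2. rewrite Hst. unfold pick.
      destruct (excluded_middle_informative (good (pre n x ++ [true]))) as [Hg|Hg]; auto. }
  destruct (Hcov x) as [i [s [H1 H2]]]. apply cyl_inv in H2.
  apply (Hbr (length s)). rewrite <- H2. exists i. intros y Hy. exists i.
  split; auto. now exists s.
Qed.

Lemma covered_full eps : covered eps (fun _ => True) -> 1 <= eps.
Proof.
  intros [c [Hc Hsum]].
  destruct (cantor_compact c) as [n Hn]; [auto|].
  apply Rle_trans with (sum_f_R0 (fun i => mu (c i)) n); auto.
  set (C := fix C n := match n with O => c O | S n => C n ++ c (S n) end).
  assert (HC : sum_f_R0 (fun i => mu (c i)) n = mu (C n) /\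
    forall i x, (i <= n)%nat -> clopen (c i) x -> clopen (C n) x).
  { clear. induction n as [|n [IH1 IH2]].
    - split; [reflexivity|]. intros i x Hi. now replace i with O by lia.
    - simpl sum_f_R0. simpl C. split.
      + rewrite IH1. unfold mu. now rewrite sum_list_app.
      + intros i x Hi H. apply clopen_app.
        destruct (Nat.eq_dec i (S n)) as [->|Hne]; [now right|]. left.
        apply (IH2 i); auto. lia. }
  destruct HC as [-> HC]. apply mu_full. intro x.
  destruct (Hn x) as [i [H1 H2]]. now apply (HC i).
Qed.

Lemma covered_union a b A B :
  covered a A -> covered b B -> covered (a + b) (fun x => A x \/ B x).
Proof.
  intros [c [Hc1 Hc2]] [d [Hd1 Hd2]]. exists (fun i => c i ++ d i). split.
  - intros x [Hx|Hx]; [destruct (Hc1 x Hx) as [i Hi]|destruct (Hd1 x Hx) as [i Hi]];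
      exists i; apply clopen_app; auto.
  - intro n. specialize (Hc2 n). specialize (Hd2 n).
    replace (sum_f_R0 (fun i => mu (c i ++ d i)) n) with
      (sum_f_R0 (fun i => mu (c i)) n + sum_f_R0 (fun i => mu (d i)) n); [lra|].
    rewrite <- plus_sum. apply sum_eq. intros i _. symmetry. apply sum_list_app.
Qed.

Lemma covered_mono a A B : covered a B -> (forall x, A x -> B x) -> covered a A.
Proof. intros [c [H1 H2]] H. exists c. split; auto. Qed.

Lemma clopen_covered_covered eps A : clopen_covered eps A -> covered eps A.
Proof.
  intros [l [Hl1 Hl2]]. exists (fun i => match i with O => l | _ => [] end). split.
  - intros x Hx. exists O. auto.
  - intro n. apply Rle_trans with (mu l); auto.
    induction n as [|n IH]; simpl; [lra|]. change (mu []) with 0. lra.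
Qed.

(** * Fibers of coded functions *)

(** Equivalent to the closure being null. Finite covers are used so that each fits into one letter
    of the countable alphabet [list (list bool)]. *)
Definition clopen_null (A : (nat -> bool) -> Prop) : Prop :=
  forall N, clopen_covered ((/2) ^ N) A.

Fixpoint strings (k : nat) : list (list bool) :=
  match k with
  | O => [[]]
  | S k => map (cons true) (strings k) ++ map (cons false) (strings k)
  end.

Lemma mu_strings k : mu (strings k) = 1.
Proof.
  assert (Hmap : forall b l, mu (map (cons b) l) = /2 * mu l).
  { intros b l. unfold mu. induction l as [|a l IH]; simpl; [lra|]. rewrite IH. lra. }
  induction k as [|k IH]; [unfold mu; simpl; lra|].
  unfold mu. simpl strings. rewrite sum_list_app. fold (mu (map (cons true) (strings k))).
  fold (mu (map (cons false) (strings k))). rewrite !Hmap, IH. lra.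
Qed.

Lemma in_strings_pre k x : In (pre k x) (strings k).
Proof.
  revert x. induction k as [|k IH]; intro x; simpl; auto.
  apply in_or_app. destruct (x O); [left|right]; apply in_map, IH.
Qed.

Lemma sum_list_at_most_one {A : Type} (t : A -> bool) (w : R) (l : list A) :
  0 <= w -> NoDup l ->
  (forall a b, In a l -> In b l -> t a = true -> t b = true -> a = b) ->
  sum_list (fun a => if t a then w else 0) l <= w.
Proof.
  intros Hw Hnd. induction Hnd as [|a l Ha Hl IH]; intro Hone; simpl; [exact Hw|].
  destruct (t a) eqn:E.
  - assert (H : sum_list (fun a => if t a then w else 0) l <= sum_list (fun _ => 0) l).
    { apply sum_list_le. intros b Hb. destruct (t b) eqn:E'; [|lra].
      elim Ha. replace a with b; auto. apply Hone; simpl; auto. }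
    rewrite sum_list_const in H. lra.
  - assert (H : sum_list (fun a => if t a then w else 0) l <= w); [|lra].
    apply IH. intros b c Hb Hc. apply Hone; simpl; auto.
Qed.

(** Sum in the other order: each string of [S] passes at most one of the filters, so its weight is
    counted at most once. *)
Lemma mu_disjoint_filters {A : Type} (t : A -> list bool -> bool) (ys : list A) S :
  NoDup ys ->
  (forall s a b, In a ys -> In b ys -> t a s = true -> t b s = true -> a = b) ->
  sum_list (fun a => mu (filter (t a) S)) ys <= mu S.
Proof.
  intros Hnd Hone. induction S as [|s S IH].
  - simpl filter. change (mu []) with 0. rewrite sum_list_const. lra.
  - change (mu (s :: S)) with ((/2) ^ length s + mu S).
    assert (H : sum_list (fun a => if t a s then (/2) ^ length s else 0) ys <= (/2) ^ length s).
    { apply sum_list_at_most_one; auto; [apply pow_le; lra|]. intros a b; apply Hone. }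
    assert (E : sum_list (fun a => mu (filter (t a) (s :: S))) ys =
      sum_list (fun a => if t a s then (/2) ^ length s else 0) ys +
      sum_list (fun a => mu (filter (t a) S)) ys).
    { clear. induction ys as [|a ys IH]; simpl; [lra|]. simpl in IH. rewrite IH.
      destruct (t a s); [unfold mu at 1; simpl; fold (mu (filter (t a) S))|]; lra. }
    rewrite E. lra.
Qed.

Lemma uniform_bound {A : Type} (P : A -> nat -> Prop) (l : list A) :
  (forall a n m, (n <= m)%nat -> P a n -> P a m) ->
  (forall a, In a l -> exists n, P a n) -> exists n, forall a, In a l -> P a n.
Proof.
  intro Hmono. induction l as [|a l IH]; intro H; [now exists O|].
  destruct IH as [n Hn]; [intros b Hb; apply H; now right|].
  destruct (H a) as [m Hm]; [now left|].
  exists (n + m)%nat. intros b [<-|Hb]; [apply (Hmono a m)|apply (Hmono b n)]; auto; lia.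
Qed.

(* The closed set of points whose value under the function with approximations [val n] at
   precision [2^-n], depending on the first [lev n] digits, may be [y]. *)
Definition fiber (lev : nat -> nat) (val : nat -> list bool -> nat) (y : R)
    (x : nat -> bool) : Prop :=
  forall n, Rabs (y - INR (val n (pre (lev n) x)) * (/2) ^ n) <= 2 * (/2) ^ n.

Lemma separation_level (y y' : R) :
  y <> y' -> exists n, forall m, (n <= m)%nat -> 4 * (/2) ^ m < Rabs (y - y').
Proof.
  intro Hne. assert (Hpos : 0 < Rabs (y - y')) by (apply Rabs_pos_lt; lra).
  destruct (pow_arbitrarily_small (/2) (Rabs (y - y') / 4)) as [n Hn]; [lra|lra|].
  exists n. intros m Hm. apply (pow_decr (/2)) in Hm; [|lra]. lra.
Qed.

Lemma close_to_common (y y' z e : R) :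
  Rabs (y - z) <= 2 * e -> Rabs (y' - z) <= 2 * e -> Rabs (y - y') <= 4 * e.
Proof.
  intros H H'. replace (y - y') with ((y - z) - (y' - z)) by lra.
  apply Rabs_le.
  unfold Rabs in H, H'. destruct (Rcase_abs (y - z)), (Rcase_abs (y' - z)); lra.
Qed.

Lemma fiber_value_unique lev val x y y' :
  fiber lev val y x -> fiber lev val y' x -> y = y'.
Proof.
  intros H H'. apply NNPP. intro Hne. destruct (separation_level y y' Hne) as [n Hn].
  specialize (Hn n (Nat.le_refl n)).
  assert (H1 := close_to_common _ _ _ _ (H n) (H' n)). lra.
Qed.

(* Distinct fibers are separated at a finite level, so their clopen hulls have total
   measure at most 1. *)
Lemma large_fibers_bounded lev val N (ys : list R) :
  NoDup ys ->
  (forall y, In y ys -> ~ clopen_covered ((/2) ^ N) (fiber lev val y)) ->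
  (length ys <= 2 ^ N)%nat.
Proof.
  intros Hnd Hbig.
  assert (Hsep : exists n, forall y, In y ys -> forall y', In y' ys -> y <> y' ->
    forall m, (n <= m)%nat -> 4 * (/2) ^ m < Rabs (y - y')).
  { apply (uniform_bound (fun y n => forall y', In y' ys -> y <> y' ->
      forall m, (n <= m)%nat -> 4 * (/2) ^ m < Rabs (y - y'))).
    - intros y n m Hnm H y' Hy' Hne k Hk. apply H; auto. lia.
    - intros y Hy. apply (uniform_bound (fun y' n => y <> y' ->
        forall m, (n <= m)%nat -> 4 * (/2) ^ m < Rabs (y - y'))).
      + intros y' n m Hnm H Hne k Hk. apply H; auto. lia.
      + intros y' Hy'. destruct (classic (y = y')) as [->|Hne]; [now exists O|].
        destruct (separation_level y y' Hne) as [n Hn]. now exists n. }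
  destruct Hsep as [n Hn].
  (* The strings passing [t y] form a clopen hull of the fiber over [y]. At level [n] no string is
     compatible with two values of [ys]. *)
  set (t := fun y s =>
    if Rle_dec (Rabs (y - INR (val n s) * (/2) ^ n)) (2 * (/2) ^ n) then true else false).
  assert (Ht : forall y s, t y s = true -> Rabs (y - INR (val n s) * (/2) ^ n) <= 2 * (/2) ^ n).
  { intros y s. unfold t. now destruct Rle_dec. }
  assert (H : sum_list (fun y => mu (filter (t y) (strings (lev n)))) ys <= mu (strings (lev n))).
  { apply mu_disjoint_filters; auto. intros s y y' Hy Hy' Hs Hs'.
    apply NNPP. intro Hne. specialize (Hn y Hy y' Hy' Hne n (Nat.le_refl n)).
    assert (H1 := close_to_common _ _ _ _ (Ht _ _ Hs) (Ht _ _ Hs')). lra. }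
  rewrite mu_strings in H.
  (* A hull of measure below [2^-N] would witness that its fiber is covered. Hence each hull weighs
     at least [2^-N], and at most [2^N] of them fit into total measure 1. *)
  assert (H' : sum_list (fun _ => (/2) ^ N) ys <=
    sum_list (fun y => mu (filter (t y) (strings (lev n)))) ys).
  { apply sum_list_le. intros y Hy. apply Rnot_lt_le. intro Hlt.
    apply (Hbig y Hy). exists (filter (t y) (strings (lev n))). split; [|lra].
    intros x Hx. exists (pre (lev n) x). split; [|apply cyl_pre; now intros k _].
    apply filter_In. split; [apply in_strings_pre|]. unfold t.
    destruct Rle_dec as [|Hno]; [reflexivity|]. elim Hno. apply Hx. }
  rewrite sum_list_const in H'. rewrite pow_inv in H'.
  assert (Hpos : 0 < 2 ^ N) by (apply pow_lt; lra).
  apply INR_le. rewrite pow_INR. change (INR 2) with 2.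
  apply Rmult_le_reg_r with (/ 2 ^ N); [now apply Rinv_0_lt_compat|].
  rewrite Rinv_r by lra. lra.
Qed.

Definition even_part (b : nat -> bool) : nat -> bool := fun n => b (2 * n)%nat.
Definition odd_part (b : nat -> bool) : nat -> bool := fun n => b (2 * n + 1)%nat.
Definition join (p q : nat -> bool) : nat -> bool :=
  fun n => if Nat.even n then p (Nat.div2 n) else q (Nat.div2 n).

Lemma even_part_join p q : even_part (join p q) = p.
Proof.
  apply functional_extensionality. intro n. unfold even_part, join.
  rewrite Nat.even_mul. cbn [Nat.even orb]. now rewrite Nat.div2_double.
Qed.

Lemma odd_part_join p q : odd_part (join p q) = q.
Proof.
  apply functional_extensionality. intro n. unfold odd_part, join.
  rewrite Nat.even_add, Nat.even_mul. cbn [Nat.even orb Bool.eqb].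
  rewrite Nat.add_1_r. now rewrite Nat.div2_succ_double.
Qed.

(* Among continuum many disjoint copies [{join p q | q}] of the Cantor set, one has only
   null fibers, and a small set of points cannot meet all of its fibers. *)
Lemma null_fiber_missing (psi : (nat -> bool) -> R) lev val (I : Type) (x : I -> nat -> bool) :
  (forall b b', psi b = psi b' -> b = b') ->
  ~ surjects I (nat -> bool) ->
  exists b, clopen_null (fiber lev val (psi b)) /\ forall i, ~ fiber lev val (psi b) (x i).
Proof.
  intros Hinj Hsmall.
  assert (Hlist : forall N, exists l, forall y,
    ~ clopen_covered ((/2) ^ N) (fiber lev val y) -> In y l).
  { intro N. apply (finite_of_bounded_length _ _ (2 ^ N)).
    intros l Hnd Hl. now apply (large_fibers_bounded lev val N). }
  apply choice in Hlist. destruct Hlist as [L HL].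
  (* [u] lists all values with a non-null fiber. The diagonal sequence [p] is not the even part of
     any code of such a value, so every [join p q] has a null fiber. *)
  set (u := fun k => nth (snd (of_nat k)) (L (fst (of_nat k))) 0).
  set (b0 := fun _ : nat => true).
  set (v := fun k => even_part (epsilon (inhabits b0) (fun b => psi b = u k))).
  set (p := fun k => negb (v k k)).
  assert (Hp : forall q, clopen_null (fiber lev val (psi (join p q)))).
  { intros q N. apply NNPP. intro Hbad. apply HL in Hbad.
    destruct (In_nth _ _ 0 Hbad) as [j [_ Hj]].
    assert (E : psi (join p q) = u (to_nat (N, j))).
    { unfold u. rewrite cancel_of_to. unfold fst, snd. now rewrite Hj. }
    set (k := to_nat (N, j)) in *. clearbody k.
    assert (Hv : v k = p).
    { unfold v. rewrite <- (even_part_join p q). f_equal. apply Hinj. rewrite E.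
      apply (epsilon_spec (inhabits b0) (fun b => psi b = u k)). now exists (join p q). }
    assert (Hk : p k = negb (p k)) by (unfold p at 1; now rewrite Hv).
    destruct (p k); discriminate. }
  apply NNPP. intro Hno. apply Hsmall.
  (* If every fiber over some [join p q] met the family, sending [i] to the unique [q] whose fiber
     contains [x i] would map [I] onto the Cantor space. *)
  apply (surjects_of_cover _ _ b0 (fun i q => fiber lev val (psi (join p q)) (x i))).
  - intros i q q' H H'. rewrite <- (odd_part_join p q), <- (odd_part_join p q').
    f_equal. apply Hinj. now apply (fiber_value_unique lev val (x i)).
  - intro q. apply NNPP. intro Hq. apply Hno. exists (join p q). split; [apply Hp|].
    intros i Hi. apply Hq. now exists i.
Qed.

(* A clopen-null set [F i] is coded by a sequence of clopen neighbourhoods of measure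
   [2^-(n+1)]; two codes that agree at index [n] share a neighbourhood, so an efficient
   cover of the set of codes yields a cover of the union of the [F i] of small measure. *)
Lemma small_union_covered (s q : R) (I : Type) (F : I -> (nat -> bool) -> Prop) (eps : R) :
  0 < s -> 0 < q < 1 -> Rpower q s = /2 ->
  (forall Y : (nat -> list (list bool)) -> Prop,
     ~ surjects {z | Y z} (nat -> bool) -> ~ hausdorff_dim_ge (sub_dist q Y) s) ->
  ~ surjects I (nat -> bool) -> (forall i, clopen_null (F i)) -> 0 < eps ->
  covered eps (fun x => exists i, F i x).
Proof.
  intros Hs Hq Eq Hdim HI HF He.
  assert (Hcode : forall i, exists z : nat -> list (list bool),
    forall n, (forall x, F i x -> clopen (z n) x) /\ mu (z n) <= (/2) ^ S n).
  { intro i. apply choice with (R := fun n l =>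
      (forall x, F i x -> clopen l x) /\ mu l <= (/2) ^ S n). intro n. apply HF. }
  apply choice in Hcode. destruct Hcode as [z Hz].
  set (Y := fun y => exists i, y = z i).
  assert (HY : ~ hausdorff_dim_ge (sub_dist q Y) s).
  { apply Hdim. intro H. apply HI. now apply (surjects_sig_range _ _ _ z). }
  assert (Hnull : exists t, (0 <= t < s) /\ hausdorff_null (sub_dist q Y) t (fun _ => True)).
  { apply NNPP. intro Hno. apply HY. intros t H1 H2 H3. apply Hno. exists t. auto. }
  destruct Hnull as [t [Ht Hnull]].
  destruct (hausdorff_null_agree s q t Y eps) as [U [k [w [H1 [H2 [H3 [H4 H5]]]]]]]; auto.
  assert (Hc : forall i, exists l, (forall y, U i y -> l = y (k i)) /\ mu l <= w i).
  { intro i. destruct (classic (exists y, U i y)) as [[y Hy]|Hno].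
    - exists (y (k i)). split.
      + intros y' Hy'. apply (H3 i y y' Hy Hy'). lia.
      + destruct (H2 i y Hy) as [[j ->] Hw]. apply Rle_trans with ((/2) ^ S (k i)); auto.
        apply Hz.
    - exists []. split; [|apply H4]. intros y Hy. elim Hno. now exists y. }
  apply choice in Hc. destruct Hc as [c Hc]. exists c. split.
  - intros x [i Hx]. destruct (H1 (z i)) as [j Hj]; [now exists i|].
    exists j. rewrite (proj1 (Hc j) _ Hj). now apply Hz.
  - intro n. apply Rle_trans with (sum_f_R0 w n); auto.
    apply sum_Rle. intros j _. apply Hc.
Qed.

(** A cover set whose members agree on [k + 1] digits lies in a single cylinder of measure
    [2^-(k+1)], and its weight dominates that measure. *)
Lemma covered_of_hausdorff_null (s q t : R) (P : (nat -> bool) -> Prop) (eps : R) :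
  0 < s -> 0 < q < 1 -> Rpower q s = /2 -> 0 <= t < s -> 0 < eps ->
  hausdorff_null (sub_dist q P) t (fun _ => True) -> covered eps P.
Proof.
  intros Hs Hq Eq Ht He Hnull.
  destruct (hausdorff_null_agree s q t P eps) as [U [k [w [H1 [H2 [H3 [H4 H5]]]]]]]; auto.
  assert (Hc : forall i, exists l, (forall y, U i y -> clopen l y) /\ mu l <= w i).
  { intro i. destruct (classic (exists y, U i y)) as [[y Hy]|Hno].
    - exists [pre (S (k i)) y]. split.
      + intros y' Hy'. exists (pre (S (k i)) y). split; [now left|]. now apply cyl_pre, (H3 i).
      + apply Rle_trans with ((/2) ^ S (k i)); [|now apply (H2 i y)].
        unfold mu, sum_list, fold_right. rewrite length_pre. lra.
    - exists []. split; [|apply H4]. intros y Hy. elim Hno. now exists y. }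
  apply choice in Hc. destruct Hc as [c Hc]. exists c. split.
  - intros x Hx. destruct (H1 x Hx) as [j Hj]. exists j. now apply Hc.
  - intro n. apply Rle_trans with (sum_f_R0 w n); auto.
    apply sum_Rle. intros j _. apply Hc.
Qed.

(* A uniformly continuous function on a subspace is determined, up to [fiber], by
   countably many natural numbers. *)
Lemma unif_continuous_coded (q : R) (P : (nat -> bool) -> Prop) (f : {x | P x} -> R) :
  0 < q < 1 -> unif_continuous (sub_dist q P) f -> (forall x, 0 <= f x) ->
  exists lev val, forall x, fiber lev val (f x) (proj1_sig x).
Proof.
  intros Hq Hf Hpos.
  assert (Hlev : forall n, exists k, forall x y : {x | P x},
    agree k (proj1_sig x) (proj1_sig y) -> Rabs (f x - f y) < (/2) ^ n).
  { intro n. destruct (Hf ((/2) ^ n)) as [delta [Hd H]]; [apply pow_lt; lra|].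
    destruct (pow_arbitrarily_small q delta Hq Hd) as [k Hk]. exists k.
    intros x y Hxy. apply H. apply Rle_lt_trans with (q ^ k); auto.
    now apply seq_dist_le_pow. }
  apply choice in Hlev. destruct Hlev as [lev Hlev].
  assert (Hval : forall ns : nat * list bool, exists v : nat, forall x : {x | P x},
    pre (lev (fst ns)) (proj1_sig x) = snd ns ->
    Rabs (f x - INR v * (/2) ^ fst ns) <= 2 * (/2) ^ fst ns).
  { intros [n sigma]. simpl. assert (Hp : 0 < (/2) ^ n) by (apply pow_lt; lra).
    destruct (classic (exists x : {x | P x}, pre (lev n) (proj1_sig x) = sigma)) as [[x0 Hx0]|Hno].
    2: { exists O. intros x Hx. elim Hno. now exists x. }
    assert (Hp' : 0 < 2 ^ n) by (apply pow_lt; lra).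
    assert (Hone : 2 ^ n * (/2) ^ n = 1).
    { rewrite pow_inv. apply Rinv_r. lra. }
    set (u := f x0 * 2 ^ n).
    assert (Hu : 0 <= u) by (apply Rmult_le_pos; [apply Hpos|lra]).
    destruct (archimed u) as [A1 A2].
    assert (HZ : (0 < up u)%Z) by (apply lt_IZR; lra).
    (* Rounding up costs at most one unit [2^-n] and the oscillation on the cylinder less than one
       more, whence the factor 2 in [fiber]. Since [f] is nonnegative, [Z.to_nat] loses nothing. *)
    exists (Z.to_nat (up u)). intros x Hx.
    rewrite INR_IZR_INZ, Z2Nat.id by lia.
    assert (H1 : Rabs (f x - f x0) < (/2) ^ n).
    { apply Hlev. apply agree_sym, cyl_pre. rewrite Hx, <- Hx0. apply cyl_pre. now intros j _. }
    assert (E : f x0 = u * (/2) ^ n).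
    { unfold u. rewrite Rmult_assoc, Hone. lra. }
    assert (H2 : u * (/2) ^ n < IZR (up u) * (/2) ^ n) by (apply Rmult_lt_compat_r; lra).
    assert (H3 : (IZR (up u) - u) * (/2) ^ n <= 1 * (/2) ^ n) by (apply Rmult_le_compat_r; lra).
    apply Rabs_def2 in H1. apply Rabs_le. lra. }
  apply choice in Hval. destruct Hval as [val Hval].
  exists lev, (fun n sigma => val (n, sigma)). intros x n.
  now apply (Hval (n, pre (lev n) (proj1_sig x))).
Qed.

(** * The construction *)

(** The hypothesis on [Y] is the second case of the dichotomy; through [small_union_covered] it
    makes the union of the earlier fibers null at every stage. *)
Lemma non_null_set_missing_fibers (s q : R) (psi : (nat -> bool) -> R) :
  0 < s -> 0 < q < 1 -> Rpower q s = /2 ->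
  (forall Y : (nat -> list (list bool)) -> Prop,
     ~ surjects {z | Y z} (nat -> bool) -> ~ hausdorff_dim_ge (sub_dist q Y) s) ->
  (forall b b', psi b = psi b' -> b = b') ->
  exists P : (nat -> bool) -> Prop,
    ~ covered (/4) P /\
    forall lev val, exists b, forall x, P x -> ~ fiber lev val (psi b) x.
Proof.
  intros Hs Hq Eq Hdim Hinj.
  destruct (small_segments_well_order (nat -> bool)) as [W [lt [Hwf [Htri [HW Hseg]]]]].
  (* The three components of a task carry the approximations [val], the levels [lev] and a cover;
     the last two are read only at the empty string. *)
  assert (HT : surjects W (nat * list bool -> nat * nat * list (list bool))).
  { apply (surjects_trans _ _ _ HW). apply surjects_cantor_fun;
    repeat first [apply surjects_nat_pair | apply surjects_nat_list
                 | apply surjects_nat_nat | apply surjects_nat_bool]. }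
  destruct HT as [task Htask].
  set (fib := fun w => fiber (fun n => snd (fst (task w (n, []))))
                             (fun n sigma => fst (fst (task w (n, sigma))))).
  set (cov := fun w i => snd (task w (i, []))).
  set (thin := fun w => forall n, sum_f_R0 (fun i => mu (cov w i)) n <= /4).
  set (b0 := fun _ : nat => true).
  (* Stage [w] returns a new point [fst u] and the code [snd u] of a value to be missed. Points and
     fibers exclude each other in both directions of the order and at the stage itself. *)
  destruct (well_founded_choice W ((nat -> bool) * (nat -> bool)) lt (b0, b0)
    (fun w f u =>
       clopen_null (fib w (psi (snd u))) /\
       (forall v, lt v w -> ~ fib w (psi (snd u)) (fst (f v))) /\
       ~ fib w (psi (snd u)) (fst u) /\
       (forall v, lt v w -> ~ fib v (psi (snd (f v))) (fst u)) /\
       (thin w -> forall i, ~ clopen (cov w i) (fst u)))) as [f Hf]; [exact Hwf| | |].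
  - intros w f g u E [H1 [H2 [H3 [H4 H5]]]]. repeat split; auto.
    + intros v Hv. rewrite <- E by auto. auto.
    + intros v Hv. rewrite <- E by auto. auto.
  - intros w f IH.
    destruct (null_fiber_missing psi (fun n => snd (fst (task w (n, []))))
      (fun n sigma => fst (fst (task w (n, sigma)))) {v | lt v w}
      (fun v => fst (f (proj1_sig v)))) as [b [Hb1 Hb2]]; auto.
    fold (fib w) in Hb1, Hb2.
    (* The current cover (if thin), the earlier fibers and the new fiber each get budget 1/4. Their
       total 3/4 is below 1, so some point avoids all three. *)
    assert (C1 : covered (/4) (fun x => thin w /\ exists i, clopen (cov w i) x)).
    { destruct (classic (thin w)) as [Hw|Hw].
      - exists (cov w). split; [now intros x [_ Hx]|exact Hw].
      - exists (fun _ => []). split; [now intros x [Hx _]|].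
        intro n. rewrite sum_cte. change (mu []) with 0. lra. }
    assert (C2 : covered (/4) (fun x => exists v : {v | lt v w},
      fib (proj1_sig v) (psi (snd (f (proj1_sig v)))) x)).
    { apply (small_union_covered s q); auto; [|lra]. intros [v Hv]. now apply IH. }
    assert (C3 : covered ((/2) ^ 2) (fib w (psi b))).
    { apply clopen_covered_covered, Hb1. }
    assert (C := covered_union _ _ _ _ (covered_union _ _ _ _ C1 C2) C3).
    apply NNPP. intro Hno.
    assert (Hle : 1 <= /4 + /4 + (/2) ^ 2); [|simpl in Hle; lra].
    apply covered_full. apply (covered_mono _ _ _ C). intros x _.
    apply NNPP. intro Hx. apply Hno. exists (x, b). simpl. repeat split; auto.
    + intros v Hv. exact (Hb2 (exist _ v Hv)).
    + intros v Hv H. apply Hx. left; right. now exists (exist _ v Hv).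
    + intros Hw i Hi. apply Hx. left; left. split; auto. now exists i.
  - exists (fun x => exists w, x = fst (f w)). split.
    + intros [c [Hc1 Hc2]].
      (* A cover of the set with measure at most 1/4 would itself be the cover of some stage [w],
         whose point was chosen outside it. *)
      destruct (Htask (fun ns => (O, O, c (fst ns)))) as [w Hw].
      assert (E : cov w = c) by (unfold cov; now rewrite Hw).
      destruct (Hf w) as [_ [_ [_ [_ H]]]].
      destruct (Hc1 (fst (f w))) as [i Hi]; [now exists w|].
      rewrite <- E in Hi. apply H in Hi; auto. unfold thin. now rewrite E.
    + intros lev val.
      destruct (Htask (fun ns => (val (fst ns) (snd ns), lev (fst ns), []))) as [w Hw].
      assert (E : fib w = fiber lev val) by (unfold fib; now rewrite Hw).
      exists (snd (f w)). rewrite <- E. intros x [v ->].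
      (* Earlier points are avoided by the choice of the value at stage [w], the stage's own point
         and all later points by the choice of the point. *)
      destruct (Htri v w) as [Hlt|[->|Hlt]].
      * now apply (Hf w).
      * now destruct (Hf w) as [_ [_ [H _]]].
      * now apply (Hf v).
Qed.

Lemma half_power_base (s : R) : 0 < s -> exists q, 0 < q < 1 /\ Rpower q s = /2.
Proof.
  intro Hs. exists (Rpower 2 (- / s)). split; [split|].
  - apply exp_pos.
  - rewrite <- (Rpower_O 2) by lra. apply Rpower_lt; [lra|].
    apply Rinv_0_lt_compat in Hs. lra.
  - rewrite Rpower_mult. replace (- / s * s) with (- (1)) by (field; lra).
    rewrite Rpower_Ropp, Rpower_1; lra.
Qed.

Theorem theorem3p1 :
  forall s : R, 0 < s ->
  exists (X : Type) (d : X -> X -> R),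
    is_metric d /\ separable d /\ hausdorff_dim_ge d s /\
    forall (a b : R), a < b ->
      ~ exists f : X -> R, unif_continuous d f /\ onto_interval f a b.
Proof.
  intros s Hs.
  destruct (half_power_base s Hs) as [q [Hq Eq]].
  destruct cantor_embedding as [psi [Hrange Hinj]].
  destruct (classic (exists Y : (nat -> list (list bool)) -> Prop,
    ~ surjects {z | Y z} (nat -> bool) /\ hausdorff_dim_ge (sub_dist q Y) s))
    as [[Y [Hsmall Hdim]]|Hno].
  - exists {z | Y z}, (sub_dist q Y).
    split; [now apply sub_dist_metric|]. split.
    { apply sub_dist_separable; auto. apply surjects_nat_list, surjects_nat_list, surjects_nat_bool. }
    split; [exact Hdim|]. intros a b Hab [f [_ [_ Hf]]]. apply Hsmall.
    (* The interval contains a copy of the Cantor space through [psi], so a map onto it would make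
       the small space surject onto [2^N]. *)
    apply (surjects_of_cover _ _ (fun _ => true) (fun x c => f x = a + (b - a) * psi c)).
    + intros x c c' E E'. apply Hinj. apply Rmult_eq_reg_l with (b - a); lra.
    + intro c. apply Hf. specialize (Hrange c). nra.
  - destruct (non_null_set_missing_fibers s q psi) as [P [HP Hfib]]; auto.
    { intros Y H1 H2. apply Hno. now exists Y. }
    exists {x | P x}, (sub_dist q P).
    split; [now apply sub_dist_metric|]. split.
    { apply sub_dist_separable; auto. apply surjects_nat_bool. }
    split.
    { intros t Ht1 Ht2 Hnull. apply HP.
      apply (covered_of_hausdorff_null s q t); auto. lra. }
    intros a b Hab [f [Hcont [Hf1 Hf2]]].
    (* Rescaling to [[0, 1]], where [psi] takes its values, also provides the nonnegativity needed
       for coding. *)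
    set (g := fun x => (f x - a) / (b - a)).
    destruct (unif_continuous_coded q P g) as [lev [val Hcode]]; auto.
    + intros eps He. destruct (Hcont (eps * (b - a))) as [delta [Hd H]].
      { apply Rmult_lt_0_compat; lra. }
      exists delta. split; auto. intros x y Hxy. specialize (H x y Hxy).
      unfold g. replace ((f x - a) / (b - a) - (f y - a) / (b - a))
        with ((f x - f y) / (b - a)) by (field; lra).
      unfold Rdiv. rewrite Rabs_mult, Rabs_inv, (Rabs_pos_eq (b - a)) by lra.
      apply Rmult_lt_reg_r with (b - a); [lra|].
      rewrite Rmult_assoc, Rinv_l by lra. lra.
    + intro x. unfold g. specialize (Hf1 x). apply Rmult_le_pos; [lra|].
      left. apply Rinv_0_lt_compat. lra.
    (* No point of [P] lies in the fiber over [psi c], yet surjectivity of [f] provides a point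
       where [g] equals [psi c]. *)
    + destruct (Hfib lev val) as [c Hc].
      destruct (Hf2 (a + (b - a) * psi c)) as [x Hx]; [specialize (Hrange c); nra|].
      apply (Hc (proj1_sig x) (proj2_sig x)).
      replace (psi c) with (g x); [apply Hcode|].
      unfold g. rewrite Hx. field. lra.
Qed.
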